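(* Let $y\in\mathcal Q_A$, let $\{a_n\}_{n\in\mathbb N}$ be a sequence in $A$ and let $R\in[0,+\infty)$ be defined by $$\limsup_{n\to+\infty}\big(\|a_n\|_A\big)^{1/n}=\frac1R .$$ Assume that $R>0$. Then the following two statements hold. (i) If $\Omega(y,R)\neq\emptyset$, then the power series $\mathrm P(x)=\sum_{n\in\mathbb N}(x-y)^{\cdot n}a_n$ defines a slice regular function on $\Omega(y,R)$. (ii) The spherical series $\mathrm S(x)=\sum_{n\in\mathbb N}\mathscr S_{y,n}(x)a_n$ defines a slice regular function on $\mathrm U_A(y,R)$.
   Context: Algebra. $A$ is a finite-dimensional real alternative algebra with unity $1$ (so $\mathbb R\subset A$), equipped with a real linear anti-involution $x\mapsto x^c$ (so $(x^c)^c=x$, $(xy)^c=y^cx^c$). Put $t(x):=x+x^c$, $n(x):=xx^c$. The quadratic cone is $\mathcal Q_A:=\mathbb R\cup\{x\in A: t(x)\in\mathbb R,\ n(x)\in\mathbb R,\ 4n(x)>t(x)^2\}$; $\mathbb S_A:=\{J\in\mathcal Q_A: J^2=-1\}$ is assumed non-empty; every $x\in\mathcal Q_A$ is of the form $\alpha+\beta J$ with $\alpha,\beta\in\mathbb R$, $J\in\mathbb S_A$. $A$ is equipped with a norm $\|\cdot\|_A$ such that $\|x\|_A=\sqrt{n(x)}$ for all $x\in\mathcal Q_A$. Slice functions. For $D\subset\mathbb C$ non-empty, open, conjugation invariant, its circularization is $\Omega_D:=\{\alpha+\beta J: \alpha+i\beta\in D,\ J\in\mathbb S_A\}$. A stem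 function is a map $F=F_1+iF_2:D\to A\otimes_{\mathbb R}\mathbb C$ ($F_1,F_2$ $A$-valued) with $F_1(\bar z)=F_1(z)$, $F_2(\bar z)=-F_2(z)$; it induces the slice function $\mathcal I(F):\Omega_D\to A$, $\mathcal I(F)(\alpha+\beta J):=F_1(z)+JF_2(z)$, $z=\alpha+i\beta$. $\mathcal I(F)$ is slice regular if $F$ is $C^1$ and holomorphic: $\frac{\partial F}{\partial\alpha}+i\frac{\partial F}{\partial\beta}=0$. Series and domains. For $a\in A$, $(x-y)^{\cdot n}a$ is the value at $x$ of the slice function induced by $z\mapsto(z-y)^na$. $\Delta_y(x):=x^2-x\,t(y)+n(y)$; $\mathscr S_{y,2m}(x):=\Delta_y(x)^m$, $\mathscr S_{y,2m+1}(x):=\Delta_y(x)^m(x-y)$; $\mathscr S_{y,n}(x)a$ is the value at $x$ of the slice function induced by $z\mapsto\mathscr S_{y,n}(z)a$ (products in $A\otimes_{\mathbb R}\mathbb C$). For $y=\xi+J\eta$ ($\xi,\eta\in\mathbb R$, $J\in\mathbb S_A$) and $w=\xi+i\eta$: $\Omega(y,R)$ is the circularization of $B(w,R)\cap B(\overline w,R)$, where $B(w,R)$ is the open disc of $\mathbb C$ with center $w$ and radius $R$; $\mathrm U_A(y,R):=\{x\in\mathcal Q_A:\sqrt{\|\Delta_y(x)\|_A}<R\}$, which is the circularization of $\{z\in\mathbb C:\sqrt{|z-w||z-\overline w|}<R\}$. *)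

(* Defs.v *)
From mathcomp Require Import all_boot all_order all_algebra.
From mathcomp Require Import all_classical all_reals all_analysis.

Set Implicit Arguments.
Unset Strict Implicit.
Unset Printing Implicit Defensive.

Import Order.TTheory GRing.Theory Num.Theory.
Import numFieldNormedType.Exports.

Local Open Scope classical_set_scope.
Local Open Scope ring_scope.

(* GRing algebras are associative, hence this record over a normed space.
   The norm of [A] is only a vector space norm; it is tied to the algebra by
   [norm_compatible] below. *)
Record alt_star_algebra (R : realType) (A : normedModType R) :=
  AltStarAlgebra {
  aone : A;
  amul : A -> A -> A;
  aconj : A -> A;
  afindim : exists (d : nat) (b : 'I_d -> A),
    forall x, exists c : 'I_d -> R, x = \sum_(i < d) c i *: b i;
  aone_neq0 : aone != 0;
  amul1l : forall x, amul aone x = x;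
  amul1r : forall x, amul x aone = x;
  amul_linl : forall k x y z, amul (k *: x + y) z = k *: amul x z + amul y z;
  amul_linr : forall k x y z, amul z (k *: x + y) = k *: amul z x + amul z y;
  amul_altl : forall x y, amul x (amul x y) = amul (amul x x) y;
  amul_altr : forall x y, amul (amul y x) x = amul y (amul x x);
  aconj_lin : forall k x y, aconj (k *: x + y) = k *: aconj x + aconj y;
  aconjK : forall x, aconj (aconj x) = x;
  aconjM : forall x y, aconj (amul x y) = amul (aconj y) (aconj x)
}.

Section QuadraticCone.
Context (R : realType) (A : normedModType R) (S : alt_star_algebra A).
Local Notation "x ** y" := (amul S x y) (at level 40, left associativity).

Definition areal (k : R) : A := k *: aone S.
Definition atrace (x : A) : A := x + aconj S x.
Definition asqnorm (x : A) : A := x ** aconj S x.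

Definition quadratic_cone : set A :=
  [set x | (exists k, x = areal k) \/
           (exists t n, [/\ atrace x = areal t, asqnorm x = areal n
                          & t ^+ 2 < 4 * n])].

Definition imag_units : set A :=
  [set J | quadratic_cone J /\ J ** J = - aone S].

Definition norm_compatible : Prop :=
  forall x n, quadratic_cone x -> asqnorm x = areal n -> `|x| = Num.sqrt n.

End QuadraticCone.

(* The complex plane is [R * R], with [(alpha, beta)] standing for
   [alpha + i beta], and the tensor product of [A] with the complex field is
   [A * A], with [(p, q)] standing for [p + i q]. *)
Section SliceFunctions.
Context (R : realType) (A : normedModType R) (S : alt_star_algebra A).

Definition cconj (z : R * R) : R * R := (z.1, - z.2).

Definition cdisc (w : R * R) (r : R) : set (R * R) :=
  [set z | Num.sqrt ((z.1 - w.1) ^+ 2 + (z.2 - w.2) ^+ 2) < r].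

Definition acmul (u v : A * A) : A * A :=
  (amul S u.1 v.1 - amul S u.2 v.2, amul S u.1 v.2 + amul S u.2 v.1).
Definition acpow (u : A * A) (n : nat) : A * A :=
  iter n (acmul u) (aone S, 0).
Definition acI (u : A * A) : A * A := (- u.2, u.1).
Definition ac_of_alg (a : A) : A * A := (a, 0).
Definition ac_of_C (z : R * R) : A * A := (areal S z.1, areal S z.2).

Definition slice_point (z : R * R) (J : A) : A := areal S z.1 + z.2 *: J.

Definition circularization (D : set (R * R)) : set A :=
  [set x | exists z J, [/\ D z, imag_units S J & x = slice_point z J]].

Definition stem_function (D : set (R * R)) (F : R * R -> A * A) : Prop :=
  forall z, D z ->
    (F (cconj z)).1 = (F z).1 /\ (F (cconj z)).2 = - (F z).2.

(* For a stem function [F] on [D] and [x] in the circularization of [D], the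
   set below is a singleton: the pair [(z, J)] is determined by [x] up to
   [(cconj z, - J)] when [x] is not real, and [(F z).2 = 0] when [z] is real. *)
Definition slice_function (F : R * R -> A * A) (x : A) : A :=
  xget 0 [set v | exists z J,
    [/\ imag_units S J, x = slice_point z J
      & v = (F z).1 + amul S J (F z).2]].

Definition dalpha (F : R * R -> A * A) (z : R * R) : A * A :=
  'D_((1, 0) : R * R) F z.
Definition dbeta (F : R * R -> A * A) (z : R * R) : A * A :=
  'D_((0, 1) : R * R) F z.

Definition C1_on (D : set (R * R)) (F : R * R -> A * A) : Prop :=
  forall z, D z ->
    [/\ derivable F z ((1, 0) : R * R), derivable F z ((0, 1) : R * R),
        {for z, continuous (dalpha F)} & {for z, continuous (dbeta F)}].

Definition holomorphic_on (D : set (R * R)) (F : R * R -> A * A) : Prop :=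
  forall z, D z -> dalpha F z + acI (dbeta F z) = 0.

Definition slice_regular_on (Omega : set A) (f : A -> A) : Prop :=
  exists (D : set (R * R)) (F : R * R -> A * A),
    [/\ D !=set0, open D & forall z, D z -> D (cconj z)] /\
    Omega = circularization D /\
    [/\ stem_function D F, C1_on D F, holomorphic_on D F
      & forall x, Omega x -> f x = slice_function F x].

Definition series_slice_regular_on (Omega : set A) (u : nat -> A -> A) : Prop :=
  (forall x, Omega x -> cvgn (series (fun n => u n x))) /\
  slice_regular_on Omega (fun x => limn (series (fun n => u n x))).

Definition slice_power (y : A) (n : nat) (a : A) : A -> A :=
  slice_function
    (fun z => acmul (acpow (ac_of_C z - ac_of_alg y) n) (ac_of_alg a)).

Definition Delta (y x : A) : A :=
  amul S x x - amul S x (atrace S y) + asqnorm S y.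

Definition Delta_stem (y : A) (z : R * R) : A * A :=
  acmul (ac_of_C z) (ac_of_C z) - acmul (ac_of_C z) (ac_of_alg (atrace S y))
  + ac_of_alg (asqnorm S y).

Definition spherical_stem (y : A) (n : nat) (z : R * R) : A * A :=
  if odd n then acmul (acpow (Delta_stem y z) n./2) (ac_of_C z - ac_of_alg y)
  else acpow (Delta_stem y z) n./2.

Definition spherical_power (y : A) (n : nat) (a : A) : A -> A :=
  slice_function (fun z => acmul (spherical_stem y n z) (ac_of_alg a)).

(* [w] is determined by [y] up to conjugation, which leaves the
   intersection of the two discs unchanged. *)
Definition Omega_ball (y : A) (r : R) : set A :=
  [set x | exists w J, [/\ imag_units S J, y = slice_point w J
     & circularization (cdisc w r `&` cdisc (cconj w) r) x]].

Definition U_ball (y : A) (r : R) : set A :=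
  [set x | quadratic_cone S x /\ Num.sqrt `|Delta y x| < r].

End SliceFunctions.

(* Main.v *)
(* Write y = w1 + w2 J, and e+ and e- for the idempotents (1 - iJ)/2 and
   (1 + iJ)/2 of the tensor product of A with C. Since J e+ = i e+ and
   J e- = - i e-, multiplication by z - y is multiplication by the complex
   number z - w on e+ and by z - conj w on e-. Hence both series are induced
   by stem functions of the form
     sum_n p_n(z) (e+ a_n) + q_n(z) (e- a_n),
   where p_n(z) = prod_(k < n) (z - v_k), q_n(z) = prod_(k < n) (z - conj v_k),
   with v_k = w for the power series and v_k alternating between w and conj w
   for the spherical series. In coordinates on the finite-dimensional space A,
   chosen with |coordinates| <= C |a_n|, these are scalar series of polynomials
   in z, and the bounds |p_n|, |p_n'| <= K rho^n with rho < r, locally on the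
   domain, allow termwise differentiation by dominated convergence of series. *)
Require Import Defs.
From mathcomp Require Import all_boot all_order all_algebra.
From mathcomp Require Import all_classical all_reals all_analysis.
From mathcomp Require Import ring lra.
Import Order.TTheory GRing.Theory Num.Theory.
Import numFieldNormedType.Exports.
Local Open Scope classical_set_scope.
Local Open Scope ring_scope.

Set Implicit Arguments.
Unset Strict Implicit.
Unset Printing Implicit Defensive.

(** * Dominated convergence of real series and the root test *)

Lemma cvg_series_dominated (R : realType) (u M : R^nat) :
  cvgn (series M) -> (forall n, `|u n| <= M n) -> cvgn (series u).
Proof.
move=> Mcvg uM; apply: normed_cvg; apply: series_le_cvg Mcvg => //= n.
exact: le_trans (uM n).
Qed.

Lemma series_tail_le (R : realType) (u M : R^nat) (N : nat) :
  cvgn (series M) -> (forall n, `|u n| <= M n) ->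
  `|limn (series u) - series u N| <= limn (series M) - series M N.
Proof.
move=> Mcvg uM.
have ucvg := cvg_series_dominated Mcvg uM.
have c1 : series M n - series M N @[n --> \oo] --> limn (series M) - series M N.
  by apply: cvgB => //; exact: cvg_cst.
have c2 : `|series u n - series u N| @[n --> \oo] -->
    `|limn (series u) - series u N|.
  by apply: cvg_norm; apply: cvgB => //; exact: cvg_cst.
rewrite -(cvg_lim _ c1)// -(cvg_lim _ c2)//.
apply: ler_lim; [exact: cvgP c2|exact: cvgP c1|].
near=> n; have Nn : (N <= n)%N by near: n; exact: nbhs_infty_ge.
rewrite !sub_series_geq//; apply: le_trans (ler_norm_sum _ _ _) _.
by apply: ler_sum => i _; exact: uM.
Unshelve. all: by end_near. Qed.

(** Tannery's theorem: past an index [N] chosen from [M], the tails are below e/3 uniformly in [t],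
    and the finitely many remaining terms converge one by one. *)
Lemma tannery (R : realType) (T : Type) (F : set_system T) {FF : ProperFilter F}
    (f : T -> R^nat) (l M : R^nat) :
  cvgn (series M) -> (\forall t \near F, forall n, `|f t n| <= M n) ->
  (forall n, f t n @[t --> F] --> l n) ->
  limn (series (f t)) @[t --> F] --> limn (series l).
Proof.
move=> Mcvg fM fl.
have lM n : `|l n| <= M n.
  apply: cvgr_to_le (cvg_norm (fl n)) _.
  by apply: filterS fM => t.
apply/cvgrPdist_lt => e e0.
have e3 : 0 < e / 3 by rewrite divr_gt0.
have [N _ NM] := cvgr_dist_lt _ _ Mcvg _ e3.
have {NM}tail (u : R^nat) : (forall n, `|u n| <= M n) ->
    `|limn (series u) - series u N| < e / 3.
  move=> uM; apply: le_lt_trans (series_tail_le N Mcvg uM) _.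
  apply: le_lt_trans (ler_norm _) _; exact: NM (leqnn N).
have slN : series (f t) N @[t --> F] --> series l N.
  by apply: (cvg_big (op := +%R)) => //; exact: add_continuous.
have cN : \forall t \near F, `|series l N - series (f t) N| < e / 3.
  exact: (cvgr_dist_lt _ _ slN).
near=> t.
have t1 : `|series l N - series (f t) N| < e / 3 by near: t.
have t2 := tail _ lM.
have t3 : `|limn (series (f t)) - series (f t) N| < e / 3.
  by apply: tail; near: t.
have -> : limn (series l) - limn (series (f t)) =
  (limn (series l) - series l N) + ((series l N - series (f t) N)
   + (series (f t) N - limn (series (f t)))) by ring.
rewrite (le_lt_trans (ler_normD _ _))//.
have := ler_normD (series l N - series (f t) N)
   (series (f t) N - limn (series (f t))).
rewrite [X in _ <= _ + X]distrC; lra.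
Unshelve. all: by end_near. Qed.

(** The form in which the root condition is used: a geometric bound at every rate above 1/r. *)
Definition geometric_bound (R : realType) (V : normedModType R) (a : nat -> V)
    (r : R) :=
  forall s, 0 < s < r -> exists2 K, 0 <= K & forall n, `|a n| <= K * s^-1 ^+ n.

Lemma geometric_bound_limn_esup (R : realType) (A : normedModType R)
    (a : nat -> A) (r : R) :
  limn_esup (fun n : nat => (`|a n| `^ (n%:R^-1))%:E) = (r%:E^-1)%E ->
  geometric_bound a r.
Proof.
move=> + s /andP[s0 sr]; rewrite limn_esup_lim inver gt_eqF ?(lt_trans s0)// => lima.
set u := fun n => _ in lima.
have uc : esups u @ \oo --> (r^-1)%:E by rewrite -lima; exact: is_cvg_esups.
have rs : ((r^-1)%:E < (s^-1)%:E)%E by rewrite lte_fin ltf_pV2 // posrE // (lt_trans s0).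
have [N _ /(_ N (leqnn _)) uN] : \forall n \near \oo, (esups u n < (s^-1)%:E)%E.
  exact: uc (open_ereal_lt' rs).
(* Index 0 is excluded: there the exponent [n%:R^-1] is 0, and the root says nothing about [a 0]. *)
have bigN n : (N <= n)%N -> (0 < n)%N -> `|a n| <= s^-1 ^+ n.
  move=> Nn n0.
  have un : (u n < (s^-1)%:E)%E.
    apply: le_lt_trans uN; apply: ereal_sup_ubound; exists n => //.
  move: un; rewrite /u lte_fin => un.
  have -> : `|a n| = (`|a n| `^ (n%:R^-1)) ^+ n.
    rewrite -powR_mulrn ?powR_ge0// -powRrM mulVf ?pnatr_eq0 -?lt0n// powRr1//.
  by rewrite lerXn2r ?nnegrE ?powR_ge0 ?invr_ge0 ?(ltW s0) ?ltW.
have t0 m : 0 <= `|a m| * s ^+ m by rewrite mulr_ge0 // exprn_ge0 // ltW.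
(* The summand 1 serves the indices above [N]; each index up to [N] is served by its own term of the
   sum. *)
exists (1 + \sum_(m < N.+1) `|a m| * s ^+ m); first by rewrite addr_ge0 ?sumr_ge0.
move=> n; have [Nn|nN] := ltnP N n.
  apply: le_trans (bigN _ (ltnW Nn) (leq_trans _ Nn)) _ => //.
  rewrite ler_peMl ?exprn_ge0 ?invr_ge0 ?(ltW s0)// lerDl sumr_ge0 // => i _.
rewrite exprVn ler_pdivlMr ?exprn_gt0//.
have nN1 : (n < N.+1)%N by [].
rewrite (bigD1 (Ordinal nN1)) //= addrCA lerDl addr_ge0// sumr_ge0 //.
Qed.

(** * Products of linear polynomials in a complex variable *)

Section ComplexPairs.
Context {R : realType}.
Implicit Types z w : R * R.

Definition cmul z w : R * R := (z.1 * w.1 - z.2 * w.2, z.1 * w.2 + z.2 * w.1).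
Definition cmod z : R := Num.sqrt (z.1 ^+ 2 + z.2 ^+ 2).

Lemma cmod_ge0 z : 0 <= cmod z.
Proof. exact: sqrtr_ge0. Qed.

Lemma sqr_cmod z : cmod z ^+ 2 = z.1 ^+ 2 + z.2 ^+ 2.
Proof. by rewrite sqr_sqrtr // addr_ge0 ?sqr_ge0. Qed.

Lemma cmod0 : cmod 0 = 0.
Proof. by rewrite /cmod /= expr0n/= addr0 sqrtr0. Qed.

Lemma cmodM z w : cmod (cmul z w) = cmod z * cmod w.
Proof.
rewrite -sqrtrM ?addr_ge0 ?sqr_ge0//; congr Num.sqrt; rewrite /cmul/=; ring.
Qed.

Lemma le_cmodP z (x : R) : 0 <= x ->
  (cmod z <= x) = (z.1 ^+ 2 + z.2 ^+ 2 <= x ^+ 2).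
Proof. by move=> x0; rewrite -sqr_cmod ler_pXn2r// nnegrE cmod_ge0. Qed.

Lemma cmodD z w : cmod (z + w) <= cmod z + cmod w.
Proof.
rewrite le_cmodP ?addr_ge0 ?cmod_ge0// [(cmod z + _) ^+ 2]sqrrD !sqr_cmod /=.
(* Cauchy-Schwarz by the Lagrange identity: the difference of the squares is itself a square. *)
have : z.1 * w.1 + z.2 * w.2 <= cmod z * cmod w.
  have [h|h] := leP 0 (z.1 * w.1 + z.2 * w.2); last first.
    by rewrite (le_trans (ltW h))// mulr_ge0 ?cmod_ge0.
  rewrite -ler_sqr ?nnegrE ?mulr_ge0 ?cmod_ge0// exprMn !sqr_cmod -subr_ge0.
  rewrite (_ : _ - _ = (z.1 * w.2 - z.2 * w.1) ^+ 2) ?sqr_ge0//; ring.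
rewrite mulr2n; nra.
Qed.

Lemma normr_fst_cmod z : `|z.1| <= cmod z.
Proof. by rewrite -sqrtr_sqr ler_sqrt// ?addr_ge0 ?sqr_ge0// lerDl sqr_ge0. Qed.

Lemma normr_snd_cmod z : `|z.2| <= cmod z.
Proof. by rewrite -sqrtr_sqr ler_sqrt// ?addr_ge0 ?sqr_ge0// lerDr sqr_ge0. Qed.

Lemma cmodZ (k : R) z : cmod (k *: z) = `|k| * cmod z.
Proof.
rewrite /cmod /= -sqrtr_sqr -sqrtrM ?sqr_ge0//; congr Num.sqrt.
rewrite /GRing.scale /=; ring.
Qed.

Lemma cmod_continuous : continuous cmod.
Proof.
move=> z; apply: continuous_comp; last exact: sqrt_continuous.
apply: cvgD; (rewrite !expr2; apply: cvgM);
  [exact: cvg_fst|exact: cvg_fst|exact: cvg_snd|exact: cvg_snd].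
Qed.

Lemma cmod_cconj z : cmod (cconj z) = cmod z.
Proof. by rewrite /cmod /= sqrrN. Qed.

Lemma cconjB z w : cconj (z - w) = cconj z - cconj w.
Proof. by rewrite /cconj /= opprD. Qed.

Lemma cconjM z w : cconj (cmul z w) = cmul (cconj z) (cconj w).
Proof. by rewrite /cconj /cmul /=; congr (_, _); ring. Qed.

Lemma cconjK : involutive (@cconj R).
Proof. by case=> x1 x2; rewrite /cconj /= opprK. Qed.

Lemma cmulC : commutative cmul.
Proof. by move=> z w; rewrite /cmul; congr (_, _); ring. Qed.

Lemma cmulA : associative cmul.
Proof. by move=> z w t; rewrite /cmul; congr (_, _) => /=; ring. Qed.

Lemma cmul1z z : cmul (1, 0) z = z.
Proof. by rewrite /cmul /=; case: z => x1 x2 /=; congr (_, _); ring. Qed.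

Fixpoint cprod (w : nat -> R * R) (n : nat) z : R * R :=
  if n is m.+1 then cmul (z - w m) (cprod w m z) else (1, 0).

Fixpoint cprod_deriv (w : nat -> R * R) (n : nat) z : R * R :=
  if n is m.+1 then cprod w m z + cmul (z - w m) (cprod_deriv w m z) else 0.

Lemma cprod_cconj (w : nat -> R * R) n z :
  cprod (fun k => cconj (w k)) n (cconj z) = cconj (cprod w n z).
Proof.
elim: n => [|n IH] /=; first by rewrite /cconj /= oppr0.
by rewrite IH cconjM cconjB.
Qed.

Lemma is_derive_fst z v : is_derive z v (fst : R * R -> R) v.1.
Proof.
suff h : (fun h : R => h^-1 *: ((fst \o shift z) (h *: v) - z.1)) @ 0^' --> v.1.
  by apply: DeriveDef; [exact: cvgP h|exact: cvg_lim h].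
apply: cvg_near_cst; near=> h.
rewrite /= addrK /GRing.scale /= mulrA mulVf ?mul1r//.
by near: h; exact: nbhs_dnbhs_neq.
Unshelve. all: by end_near. Qed.

Lemma is_derive_snd z v : is_derive z v (snd : R * R -> R) v.2.
Proof.
suff h : (fun h : R => h^-1 *: ((snd \o shift z) (h *: v) - z.2)) @ 0^' --> v.2.
  by apply: DeriveDef; [exact: cvgP h|exact: cvg_lim h].
apply: cvg_near_cst; near=> h.
rewrite /= addrK /GRing.scale /= mulrA mulVf ?mul1r//.
by near: h; exact: nbhs_dnbhs_neq.
Unshelve. all: by end_near. Qed.

(** Recording the derivative as a complex number times the direction [v] keeps the Cauchy-Riemann
    equations available for the sums. *)
Lemma is_derive_cprod (w : nat -> R * R) n z v :
  is_derive z v (fun z => (cprod w n z).1) (cmul (cprod_deriv w n z) v).1 /\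
  is_derive z v (fun z => (cprod w n z).2) (cmul (cprod_deriv w n z) v).2.
Proof.
elim: n => [|n [IH1 IH2]] /=.
  by rewrite !mul0r subr0 addr0; split; exact: is_derive_cst.
have d1 := is_deriveB (is_derive_fst z v) (is_derive_cst (w n).1 z v).
have d2 := is_deriveB (is_derive_snd z v) (is_derive_cst (w n).2 z v).
split.
- apply: is_derive_eq (is_deriveB (is_deriveM d1 IH1) (is_deriveM d2 IH2)) _.
  rewrite /GRing.scale /= /cst !fctE /=; ring.
- apply: is_derive_eq (is_deriveD (is_deriveM d1 IH2) (is_deriveM d2 IH1)) _.
  rewrite /GRing.scale /= /cst !fctE /=; ring.
Qed.

Lemma continuous_cprod (w : nat -> R * R) n :
  continuous (fun z => (cprod w n z).1) /\ continuous (fun z => (cprod w n z).2).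
Proof.
elim: n => [|n [IH1 IH2]] /=; first by split => z; exact: cvg_cst.
have c1 : continuous (fun z : R * R => z.1 - (w n).1).
  by move=> z; apply: cvgB; [exact: cvg_fst|exact: cvg_cst].
have c2 : continuous (fun z : R * R => z.2 - (w n).2).
  by move=> z; apply: cvgB; [exact: cvg_snd|exact: cvg_cst].
split=> z.
- by apply: cvgB; apply: cvgM; [exact: c1|exact: IH1|exact: c2|exact: IH2].
- by apply: cvgD; apply: cvgM; [exact: c1|exact: IH2|exact: c2|exact: IH1].
Qed.

Lemma continuous_cprod_deriv (w : nat -> R * R) n :
  continuous (fun z => (cprod_deriv w n z).1) /\
  continuous (fun z => (cprod_deriv w n z).2).
Proof.
elim: n => [|n [IH1 IH2]] /=; first by split => z; exact: cvg_cst.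
have c1 : continuous (fun z : R * R => z.1 - (w n).1).
  by move=> z; apply: cvgB; [exact: cvg_fst|exact: cvg_cst].
have c2 : continuous (fun z : R * R => z.2 - (w n).2).
  by move=> z; apply: cvgB; [exact: cvg_snd|exact: cvg_cst].
have [p1 p2] := continuous_cprod w n.
split=> z.
- apply: cvgD; first exact: p1.
  by apply: cvgB; apply: cvgM; [exact: c1|exact: IH1|exact: c2|exact: IH2].
- apply: cvgD; first exact: p2.
  by apply: cvgD; apply: cvgM; [exact: c1|exact: IH2|exact: c2|exact: IH1].
Qed.

End ComplexPairs.

(* Dominated convergence applied to the difference quotients. *)
Lemma is_derive_series (R : realType) (V : normedModType R) (u : nat -> V -> R)
    (du M : R^nat) (z v : V) :
  cvgn (series M) ->
  (forall n, is_derive z v (u n) (du n)) ->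
  (\forall h \near (0 : R),
     cvgn (series (fun n => u n (h *: v + z))) /\
     forall n, `|u n (h *: v + z) - u n z| <= `|h| * M n) ->
  is_derive z v (fun y => limn (series (fun n => u n y))) (limn (series du)).
Proof.
move=> Mcvg du_ uM.
have c0 : cvgn (series (fun n => u n z)).
  by have [+ _] := nbhs_singleton uM; rewrite scale0r add0r.
pose q (h : R) : R^nat := fun n => h^-1 *: (u n (h *: v + z) - u n z).
have qlim : limn (series (q h)) @[h --> 0^'] --> limn (series du).
  apply: (tannery Mcvg).
    near=> h => n.
    have h0 : h != 0 by near: h; exact: nbhs_dnbhs_neq.
    have [_ /(_ n) hM] : cvgn (series (fun n => u n (h *: v + z))) /\
        forall n, `|u n (h *: v + z) - u n z| <= `|h| * M n.
      by near: h; exact: nbhs_dnbhs uM.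
    by rewrite normrM normfV ler_pdivrMl ?normr_gt0.
  by move=> n; have [d e] := du_ n; rewrite -e; exact: d.
suff dq : (fun h => h^-1 *: (((fun y => limn (series (fun n => u n y)))
    \o shift z) (h *: v) - limn (series (fun n => u n z)))) @ 0^' -->
    limn (series du).
  by apply: DeriveDef; [exact: cvgP dq|exact: cvg_lim dq].
apply: cvg_trans qlim; apply: near_eq_cvg; near=> h.
have [ch _] : cvgn (series (fun n => u n (h *: v + z))) /\
        forall n, `|u n (h *: v + z) - u n z| <= `|h| * M n.
  by near: h; exact: nbhs_dnbhs uM.
rewrite /= -(lim_seriesB ch c0) -lim_seriesZ//.
exact: is_cvg_seriesB ch c0.
Unshelve. all: by end_near. Qed.

(** * Growth estimates for products of linear factors *)

Lemma bernoulli_ineq (R : realDomainType) (x : R) n :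
  0 <= x -> 1 + n%:R * x <= (1 + x) ^+ n.
Proof.
move=> x0; elim: n => [|n IH]; first by rewrite mul0r addr0.
have n0 : 0 <= n%:R :> R by [].
rewrite exprS -natr1; nra.
Qed.

Section ProductSeries.
Context {R : realType}.
Implicit Types (z : R * R) (w : nat -> R * R) (al : nat -> R).

Lemma prod_ge0_nat al n : (forall k, 0 <= al k) -> 0 <= \prod_(k < n) al k.
Proof. by move=> al0; apply: prodr_ge0. Qed.

Lemma cmod_cprod_le w al n z : (forall k, cmod (z - w k) <= al k) ->
  cmod (cprod w n z) <= \prod_(k < n) al k.
Proof.
move=> zal; elim: n => [|n IH] /=.
  by rewrite big_ord0 /cmod /= expr1n expr0n /= addr0 sqrtr1.
by rewrite big_ord_recr /= cmodM mulrC ler_pM ?cmod_ge0.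
Qed.

Section LipschitzBounds.
Variables (w : nat -> R * R) (al : nat -> R) (d : R).
Hypotheses (d0 : 0 < d) (dal : forall k, d <= al k).

Let P n := \prod_(k < n) al k.

Let P0 n : 0 <= P n.
Proof. by apply: prod_ge0_nat => k; exact: le_trans (ltW d0) (dal k). Qed.

(** Dropping one factor costs at most 1/d, as every [al k] is at least [d]; this is the induction
    step of both estimates below. *)
Let P_step n : P n + al n * (n%:R / d * P n) <= n.+1%:R / d * P n.+1.
Proof.
rewrite /P big_ord_recr /= -/(P n) -natr1.
have : P n <= d^-1 * (P n * al n).
  by rewrite ler_pdivlMl// mulrC ler_wpM2l.
rewrite [n%:R / d]mulrC; lra.
Qed.

Lemma cmod_cprod_deriv_le n z : (forall k, cmod (z - w k) <= al k) ->
  cmod (cprod_deriv w n z) <= n%:R / d * \prod_(k < n) al k.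
Proof.
move=> zal; elim: n => [|n IH] /=; first by rewrite cmod0 !mul0r.
apply: le_trans (P_step n); apply: le_trans (cmodD _ _) _.
by rewrite lerD ?cmod_cprod_le// cmodM ler_pM ?cmod_ge0.
Qed.

Lemma cmod_cprodB_le n z z' :
  (forall k, cmod (z - w k) <= al k) -> (forall k, cmod (z' - w k) <= al k) ->
  cmod (cprod w n z' - cprod w n z) <=
  cmod (z' - z) * (n%:R / d * \prod_(k < n) al k).
Proof.
move=> zal zal'; elim: n => [|n IH] /=; first by rewrite subrr cmod0 !mul0r mulr0.
(* Only one factor changes at a time: first the new one, then the shorter product. *)
have -> : cmul (z' - w n) (cprod w n z') - cmul (z - w n) (cprod w n z) =
    cmul (z' - z) (cprod w n z) + cmul (z' - w n) (cprod w n z' - cprod w n z).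
  by rewrite /cmul; apply/pair_equal_spec; split => /=; ring.
have : cmod (z' - z) * (P n + al n * (n%:R / d * P n)) <=
    cmod (z' - z) * (n.+1%:R / d * P n.+1).
  by apply: ler_wpM2l (P_step n); exact: cmod_ge0.
apply: le_trans; apply: le_trans (cmodD _ _) _.
rewrite mulrDr !cmodM lerD//; first by rewrite ler_wpM2l ?cmod_ge0 ?cmod_cprod_le.
by rewrite mulrCA ler_pM ?cmod_ge0.
Qed.

End LipschitzBounds.

(* The margin d makes the bound hold for p_n on a neighbourhood of z, and costs
   only a factor n / d for the derivative and the Lipschitz constant of p_n. *)
Definition growth_at w (r : R) z := exists d K q,
  [/\ 0 < d, 0 <= K, 0 < q < r &
      forall n, \prod_(k < n) (cmod (z - w k) + d) <= K * q ^+ n].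

(** One summable sequence controls terms, derivatives and Lipschitz constants on a whole disc:
    [|c n|] is at most a constant times s^-n with s above q, and the factor n / d is absorbed by
    enlarging q slightly. *)
Lemma growth_dominated w (r : R) z0 (c : nat -> R) :
  growth_at w r z0 -> geometric_bound c r ->
  exists M d, [/\ cvgn (series M), 0 < d & forall z z',
    cmod (z - z0) <= d -> cmod (z' - z0) <= d -> forall n,
    [/\ `|c n| * cmod (cprod w n z) <= M n,
        `|c n| * cmod (cprod_deriv w n z) <= M n &
        `|c n| * cmod (cprod w n z' - cprod w n z) <= cmod (z' - z) * M n]].
Proof.
move=> [d [K [q [d0 K0 /andP[q0 qr] PK]]]] cr.
pose s := (q + r) / 2.
have qs : q < s by rewrite /s; lra.
have sr : s < r by rewrite /s; lra.
have s0 : 0 < s by lra.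
have [K' K'0 cK'] := cr s (introT andP (conj s0 sr)).
(* The gap from [q] to [t] absorbs the linear factor n / d; the gap from [t] to [s] makes the
   geometric series converge. *)
pose t := (q + s) / 2.
have qt : q < t by rewrite /t; lra.
have ts : t < s by rewrite /t; lra.
pose x := t / q - 1.
have x0 : 0 < x by rewrite /x subr_gt0 ltr_pdivlMr ?mul1r.
have tE : t = q * (1 + x) by rewrite /x addrC subrK mulrC divfK ?gt_eqF.
(* Since n / d is (n x) / (d x), this constant gives 1 + n / d <= C (1 + n x), to which Bernoulli's
   inequality applies. *)
pose C := 1 + (d * x)^-1.
have C1 : 1 <= C by rewrite lerDl invr_ge0 mulr_ge0 ?ltW.
have Cn n : 1 + n%:R / d <= C * (1 + x) ^+ n.
  apply: le_trans (_ : C * (1 + n%:R * x) <= _); last first.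
    by rewrite ler_wpM2l ?(le_trans _ C1) ?bernoulli_ineq ?ltW.
  have -> : n%:R / d = (d * x)^-1 * (n%:R * x) by field; rewrite !gt_eqF.
  have dx : 0 <= (d * x)^-1 by rewrite invr_ge0 mulr_ge0 ?ltW.
  have nx : 0 <= n%:R * x by rewrite mulr_ge0 // ltW.
  by rewrite /C; lra.
pose M := geometric (K' * K * C) (t / s).
exists M, d; split => //.
  apply: is_cvg_geometric_series; rewrite ger0_norm.
    by rewrite ltr_pdivrMr ?mul1r.
  by apply: divr_ge0; [exact: le_trans (ltW q0) (ltW qt)|exact: ltW].
pose al k := cmod (z0 - w k) + d.
have dal k : d <= al k by rewrite lerDr cmod_ge0.
have zal z : cmod (z - z0) <= d -> forall k, cmod (z - w k) <= al k.
  move=> zd k; rewrite -(subrKA z0).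
  by apply: le_trans (cmodD _ _) _; rewrite /al addrC lerD2l.
have P0 n : 0 <= \prod_(k < n) al k.
  by apply: prod_ge0_nat => k; exact: le_trans (ltW d0) (dal k).
have n0 n : 0 <= n%:R / d by rewrite divr_ge0 // ltW.
(* The factor 1 + n / d dominates both 1 and n / d, so all three estimates follow from this one. *)
have PM n : `|c n| * ((1 + n%:R / d) * \prod_(k < n) al k) <= M n.
  rewrite /M /= (_ : _ * _ ^+ n =
    (K' * s^-1 ^+ n) * ((C * (1 + x) ^+ n) * (K * q ^+ n))).
    have n1 : 0 <= 1 + n%:R / d by rewrite addr_ge0.
    have nP : 0 <= (1 + n%:R / d) * \prod_(k < n) al k by rewrite mulr_ge0.
    exact: ler_pM (normr_ge0 _) nP (cK' n) (ler_pM n1 (P0 n) (Cn n) (PK n)).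
  by rewrite tE !exprMn; ring.
move=> z z' zd zd' n; split.
- apply: le_trans (PM n); rewrite ler_wpM2l//.
  apply: le_trans (cmod_cprod_le _ (zal _ zd)) _.
  by rewrite ler_peMl // lerDl.
- apply: le_trans (PM n); rewrite ler_wpM2l//.
  apply: le_trans (cmod_cprod_deriv_le d0 dal _ (zal _ zd)) _.
  by rewrite ler_wpM2r // lerDr.
- apply: le_trans (_ : `|c n| * (cmod (z' - z) * (n%:R / d * \prod_(k < n) al k)) <= _).
    by rewrite ler_wpM2l// cmod_cprodB_le// => k; exact: zal.
  rewrite mulrCA ler_wpM2l ?cmod_ge0//; apply: le_trans (PM n).
  by rewrite ler_wpM2l// ler_wpM2r// lerDr.
Qed.

End ProductSeries.

(** * Scalar series of products: convergence and termwise differentiation *)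

Section PowerSeries.
Context {R : realType}.
Implicit Types (z : R * R) (w : nat -> R * R) (c : nat -> R).

Definition cseries w c z : R * R :=
  (limn (series (fun n => c n * (cprod w n z).1)),
   limn (series (fun n => c n * (cprod w n z).2))).

Definition cseries_deriv w c z : R * R :=
  (limn (series (fun n => c n * (cprod_deriv w n z).1)),
   limn (series (fun n => c n * (cprod_deriv w n z).2))).

Lemma near_cmod_le (V : Type) (F : set_system V) {FF : Filter F}
    (g : V -> R * R) z0 d :
  0 < d -> g y @[y --> F] --> z0 -> \forall y \near F, cmod (g y - z0) <= d.
Proof.
move=> d0 gz.
have h : cmod (g y - z0) @[y --> F] --> 0.
  rewrite -(@cmod0 R) -(subrr z0); apply: continuous_cvg.
    exact: cmod_continuous.
  by apply: cvgB => //; exact: cvg_cst.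
have : \forall y \near F, cmod (g y - z0) < d by exact: (cvgr_lt _ h).
by apply: filterS => y /ltW.
Qed.

Section At.
Variables (w : nat -> R * R) (r : R) (z0 : R * R) (c : nat -> R).
Hypotheses (wz0 : growth_at w r z0) (cr : geometric_bound c r).

Lemma cvg_cseries :
  cvgn (series (fun n => c n * (cprod w n z0).1)) /\
  cvgn (series (fun n => c n * (cprod w n z0).2)).
Proof.
have [M [d [Mcvg d0 MP]]] := growth_dominated wz0 cr.
have zz : cmod (z0 - z0) <= d by rewrite subrr cmod0 ltW.
split; apply: cvg_series_dominated Mcvg _ => n; have [+ _ _] := MP _ _ zz zz n;
  apply: le_trans; rewrite normrM ler_wpM2l//.
- exact: normr_fst_cmod.
- exact: normr_snd_cmod.
Qed.

Lemma is_derive_cseries (v : R * R) :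
  is_derive z0 v (fun z => (cseries w c z).1)
    (cmul (cseries_deriv w c z0) v).1 /\
  is_derive z0 v (fun z => (cseries w c z).2)
    (cmul (cseries_deriv w c z0) v).2.
Proof.
have [M [d [Mcvg d0 MP]]] := growth_dominated wz0 cr.
have zz : cmod (z0 - z0) <= d by rewrite subrr cmod0 ltW.
have c1 : cvgn (series (fun n => c n * (cprod_deriv w n z0).1)).
  apply: cvg_series_dominated Mcvg _ => n; have [_ + _] := MP _ _ zz zz n.
  by apply: le_trans; rewrite normrM ler_wpM2l ?normr_fst_cmod.
have c2 : cvgn (series (fun n => c n * (cprod_deriv w n z0).2)).
  apply: cvg_series_dominated Mcvg _ => n; have [_ + _] := MP _ _ zz zz n.
  by apply: le_trans; rewrite normrM ler_wpM2l ?normr_snd_cmod.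
(* The increment [h *: v] has modulus [|h| * cmod v], so the Lipschitz bounds dominate the
   difference quotients after scaling by [cmod v]. *)
have Mvcvg : cvgn (series (cmod v *: M)) by exact: is_cvg_seriesZ.
have nearz : \forall h \near (0 : R), cmod (h *: v + z0 - z0) <= d.
  apply: (@near_cmod_le _ (nbhs (0 : R)) _ (fun h : R => h *: v + z0) z0 d d0).
  rewrite -[X in _ --> X]add0r.
  apply: cvgD; last exact: cvg_cst.
  by rewrite -[X in _ --> X](scale0r v); apply: cvgZr_tmp; exact: cvg_id.
have ex n : c n * (cmul (cprod_deriv w n z0) v).1 =
  v.1 * (c n * (cprod_deriv w n z0).1) - v.2 * (c n * (cprod_deriv w n z0).2).
  by rewrite /=; ring.
have ey n : c n * (cmul (cprod_deriv w n z0) v).2 =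
  v.2 * (c n * (cprod_deriv w n z0).1) + v.1 * (c n * (cprod_deriv w n z0).2).
  by rewrite /=; ring.
have ks k (u : R^nat) : cvgn (series u) -> cvgn (series (k *: u)).
  exact: is_cvg_seriesZ.
split.
- have -> : (cmul (cseries_deriv w c z0) v).1 =
      limn (series (fun n => c n * (cmul (cprod_deriv w n z0) v).1)).
    under eq_fun do rewrite ex.
    rewrite (lim_seriesB (ks v.1 _ c1) (ks v.2 _ c2)) !lim_seriesZ//=.
    by rewrite /GRing.scale /= mulrC [_ * v.2]mulrC.
  apply: (is_derive_series Mvcvg) => [n|].
    have [dp _] := is_derive_cprod w n z0 v.
    exact: (is_deriveZ (c n)).
  apply: filterS nearz => h hz; split.
    apply: cvg_series_dominated Mcvg _ => n; have [+ _ _] := MP _ _ hz zz n.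
    by apply: le_trans; rewrite normrM ler_wpM2l// normr_fst_cmod.
  move=> n; have [_ _] := MP _ _ zz hz n.
  rewrite addrK cmodZ -mulrA; apply: le_trans.
  by rewrite -mulrBr normrM ler_wpM2l// (normr_fst_cmod (_ - _)).
- have -> : (cmul (cseries_deriv w c z0) v).2 =
      limn (series (fun n => c n * (cmul (cprod_deriv w n z0) v).2)).
    under eq_fun do rewrite ey.
    rewrite (lim_seriesD (ks v.2 _ c1) (ks v.1 _ c2)) !lim_seriesZ//=.
    by rewrite /GRing.scale /= mulrC [_ * v.1]mulrC.
  apply: (is_derive_series Mvcvg) => [n|].
    have [_ dp] := is_derive_cprod w n z0 v.
    exact: (is_deriveZ (c n)).
  apply: filterS nearz => h hz; split.
    apply: cvg_series_dominated Mcvg _ => n; have [+ _ _] := MP _ _ hz zz n.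
    by apply: le_trans; rewrite normrM ler_wpM2l// normr_snd_cmod.
  move=> n; have [_ _] := MP _ _ zz hz n.
  rewrite addrK cmodZ -mulrA; apply: le_trans.
  by rewrite -mulrBr normrM ler_wpM2l// (normr_snd_cmod (_ - _)).
Qed.

Lemma continuous_cseries_deriv :
  {for z0, continuous (fun z => (cseries_deriv w c z).1)} /\
  {for z0, continuous (fun z => (cseries_deriv w c z).2)}.
Proof.
have [M [d [Mcvg d0 MP]]] := growth_dominated wz0 cr.
have nearz : \forall z \near z0, cmod (z - z0) <= d.
  exact: (@near_cmod_le _ (nbhs z0) _ id z0 d d0).
split; apply: (tannery Mcvg).
- apply: filterS nearz => z hz n; have [_ + _] := MP _ _ hz hz n.
  by apply: le_trans; rewrite normrM ler_wpM2l// normr_fst_cmod.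
- move=> n; apply: cvgM; first exact: cvg_cst.
  exact: (continuous_cprod_deriv w n).1.
- apply: filterS nearz => z hz n; have [_ + _] := MP _ _ hz hz n.
  by apply: le_trans; rewrite normrM ler_wpM2l// normr_snd_cmod.
- move=> n; apply: cvgM; first exact: cvg_cst.
  exact: (continuous_cprod_deriv w n).2.
Qed.

End At.
End PowerSeries.

(** * Bounded coordinates in finite dimension *)

Section FiniteDimension.
Context {R : realType} {A : normedModType R}.
Implicit Types (b : nat -> A) (c e : nat -> R).

Definition lincomb d b c : A := \sum_(i < d) c i *: b i.

(** The family [b] may be linearly dependent, so the given coefficients can be arbitrarily large;
    only some other choice [e] for the same vector can be controlled. *)
Definition bounded_coordinates d b (C : R) := forall c, exists2 e,
  lincomb d b e = lincomb d b c &
  forall i, (i < d)%N -> `|e i| <= C * `|lincomb d b c|.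

(** Combinations close to [v] can be rewritten with coefficients in a fixed box, whose image is
    compact, hence closed, and does not contain [v]. *)
Lemma dist_lincomb_gt0 d b C (v : A) : 0 <= C -> bounded_coordinates d b C ->
  (forall c, v <> lincomb d b c) ->
  exists2 m, 0 < m & forall c, m <= `|v - lincomb d b c|.
Proof.
move=> C0 bC vb.
(* A combination at distance below 1 from [v] has norm at most |v| + 1, so its controlled
   coefficients lie in [-M, M]. *)
pose M := C * (`|v| + 1).
pose phi (x : 'rV[R]_d) : A := \sum_(i < d) x ord0 i *: b i.
have phic : continuous phi.
  apply: (continuous_big (op := +%R)); first exact: add_continuous.
  move=> i _ x; apply: (continuous_comp (@coord_continuous R 1 d ord0 i x) _
    (g := fun t : R => t *: b i)).
  by apply: cvgZr_tmp.
pose K := phi @` [set x : 'rV[R]_d | forall i, `[- M, M]%classic (x ord0 i)].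
have Kclosed : closed K.
  apply: compact_closed; first exact: norm_hausdorff.
  apply: continuous_compact; first exact: continuous_subspaceT.
  by apply: (@rV_compact _ _ (fun=> `[- M, M]%classic)) => i; exact: segment_compact.
have vK : (~` K) v.
  move=> [x _ xv]; apply: (vb (fun i => oapp (fun j => x ord0 j) 0 (insub i))).
  rewrite -xv; apply: eq_bigr => i _; by rewrite valK.
have /nbhs_ballP[dl /= dl0 dlK] : nbhs v (~` K).
  by apply: open_nbhs_nbhs; split => //; exact: closed_openC.
exists (Num.min dl 1); first by rewrite lt_min dl0 ltr01.
move=> c; rewrite leNgt lt_min; apply/negP => /andP[h1 h2].
have [e eE eC] := bC c.
apply: (dlK (lincomb d b c)); first by rewrite -ball_normE.
exists (\row_i e i); last by rewrite -eE; apply: eq_bigr => i _; rewrite mxE.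
move=> i; rewrite /= in_itv /= -ler_norml mxE; apply: le_trans (eC _ _) _ => //.
rewrite ler_wpM2l//.
rewrite -[lincomb d b c](subKr v); apply: le_trans (ler_normB _ _) _.
by rewrite lerD2l ltW.
Qed.

(* Induction on the number of spanning vectors: either the last one is
   redundant, or its distance to the span of the others is positive. *)
Lemma bounded_coordinates_ex d b : exists2 C, 0 <= C & bounded_coordinates d b C.
Proof.
elim: d => [|d [C C0 bC]].
  by exists 0 => // c; exists c.
have recr c : lincomb d.+1 b c = lincomb d b c + c d *: b d.
  by rewrite /lincomb big_ord_recr.
have ext e x : lincomb d.+1 b (fun i => if (i < d)%N then e i else x) =
    lincomb d b e + x *: b d.
  rewrite recr ltnn; congr (_ + _); apply: eq_bigr => i _.
  by rewrite ltn_ord.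
have [[f bE]|nb] := pselect (exists f, b d = lincomb d b f).
  exists C => // c.
  have cE : lincomb d.+1 b c = lincomb d b (fun i => c i + c d * f i).
    rewrite recr bE /lincomb scaler_sumr -big_split /=; apply: eq_bigr => i _.
    by rewrite scalerDl scalerA.
  have [e eE eC] := bC (fun i => c i + c d * f i).
  exists (fun i => if (i < d)%N then e i else 0).
    by rewrite ext scale0r addr0 eE cE.
  move=> i _; case: ifP => [id|_]; first by rewrite cE eC.
  by rewrite normr0 mulr_ge0.
have [|m m0 mP] := dist_lincomb_gt0 (v := b d) C0 bC.
  by move=> c bE; apply: nb; exists c.
have m'0 : 0 <= m^-1 by rewrite invr_ge0 ltW.
have Cb0 : 0 <= C * (1 + `|b d| / m) by rewrite mulr_ge0// addr_ge0// mulr_ge0.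
(* The first summand bounds the coefficients of the earlier vectors, the second that of [b d]. *)
exists (C * (1 + `|b d| / m) + m^-1).
  by rewrite addr_ge0.
move=> c; set x := lincomb d.+1 b c.
(* If [c d] is nonzero, [x] is [c d] times the difference of [b d] and a combination of the earlier
   vectors, which has norm at least [m]. *)
have tx : `|c d| <= m^-1 * `|x|.
  rewrite ler_pdivlMl//.
  have [->|t0] := eqVneq (c d) 0; first by rewrite normr0 mulr0.
  have xE : x = c d *: (b d - lincomb d b (fun i => - (c d)^-1 * c i)).
    rewrite /x recr scalerBr addrC; congr (_ + _).
    rewrite -scalerN -sumrN scaler_sumr; apply: eq_bigr => i _.
    by rewrite -scaleNr scalerA mulNr opprK mulrA mulfV// mul1r.
  by rewrite xE normrZ mulrC ler_wpM2l.
have [e eE eC] := bC c.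
exists (fun i => if (i < d)%N then e i else c d); first by rewrite ext eE -recr.
have wx : `|lincomb d b c| <= (1 + `|b d| / m) * `|x|.
  have -> : lincomb d b c = x - c d *: b d by rewrite /x recr addrK.
  apply: le_trans (ler_normB _ _) _; rewrite normrZ mulrDl mul1r lerD2l.
  by rewrite mulrC -mulrA ler_wpM2l.
move=> i _; rewrite mulrDl; case: ifP => [id|_].
  apply: le_trans (eC _ id) _; apply: le_trans (_ : C * ((1 + `|b d| / m) * `|x|) <= _).
    by rewrite ler_wpM2l.
  by rewrite mulrA lerDl mulr_ge0.
apply: le_trans tx _; by rewrite lerDr mulr_ge0.
Qed.

End FiniteDimension.

(** * Alternative algebras with an anti-involution *)

Section StarAlgebra.
Context {R : realType} {A : normedModType R} (S : alt_star_algebra A).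
Implicit Types (x y : A) (z w : R * R).
Local Notation "x ** y" := (amul S x y) (at level 40, left associativity).
Local Notation one := (aone S).
Local Notation areal := (areal S).
Local Notation slice_point := (slice_point S).

Lemma amulDl x y t : (x + y) ** t = x ** t + y ** t.
Proof. by have := amul_linl S 1 x y t; rewrite !scale1r. Qed.

Lemma amulDr x y t : t ** (x + y) = t ** x + t ** y.
Proof. by have := amul_linr S 1 x y t; rewrite !scale1r. Qed.

Lemma amul0l t : 0 ** t = 0.
Proof. by apply: (addrI (0 ** t)); rewrite -amulDl !addr0. Qed.

Lemma amul0r t : t ** 0 = 0.
Proof. by apply: (addrI (t ** 0)); rewrite -amulDr !addr0. Qed.

Lemma amulZl (k : R) x t : (k *: x) ** t = k *: (x ** t).
Proof. by have := amul_linl S k x 0 t; rewrite amul0l !addr0. Qed.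

Lemma amulZr (k : R) x t : t ** (k *: x) = k *: (t ** x).
Proof. by have := amul_linr S k x 0 t; rewrite amul0r !addr0. Qed.

Lemma amulNl x t : (- x) ** t = - (x ** t).
Proof. by rewrite -scaleN1r amulZl scaleN1r. Qed.

Lemma amulNr x t : t ** (- x) = - (t ** x).
Proof. by rewrite -scaleN1r amulZr scaleN1r. Qed.

Lemma aconjD x y : aconj S (x + y) = aconj S x + aconj S y.
Proof. by have := aconj_lin S 1 x y; rewrite !scale1r. Qed.

Lemma aconj0 : aconj S 0 = 0.
Proof. by apply: (addrI (aconj S 0)); rewrite -aconjD !addr0. Qed.

Lemma aconjZ (k : R) x : aconj S (k *: x) = k *: aconj S x.
Proof. by have := aconj_lin S k x 0; rewrite aconj0 !addr0. Qed.

Lemma aconjN x : aconj S (- x) = - aconj S x.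
Proof. by rewrite -scaleN1r aconjZ scaleN1r. Qed.

Lemma aconj1 : aconj S one = one.
Proof.
by have := aconjM S (aconj S one) one; rewrite amul1r aconjK amul1r => <-.
Qed.

Lemma areal_inj : injective areal.
Proof.
move=> k k' /eqP; rewrite -subr_eq0 -scalerBl scaler_eq0 (negPf (aone_neq0 S)).
by rewrite orbF subr_eq0 => /eqP.
Qed.

Section ImaginaryUnit.
Variable J : A.
Hypothesis HJ : imag_units S J.

Lemma imag_unit_sqr : J ** J = - one.
Proof. by case: HJ. Qed.

Lemma real_neq_imag_unit (k : R) : areal k <> J.
Proof.
move=> kJ; have := imag_unit_sqr.
rewrite -kJ /areal amulZl amulZr amul1l scalerA -scaleN1r => /areal_inj.
by move=> h; have := sqr_ge0 k; rewrite expr2 h; lra.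
Qed.

(** If J has trace t, its conjugate is t - J, so n = J (t - J) = t J + 1 and t J is real. A nonzero
    t would make J real, against J J = - 1. *)
Lemma aconj_imag_unit : aconj S J = - J.
Proof.
case: (HJ) => -[[k Jk]|[t [n [tr nr tn]]]] JJ.
  by case: (real_neq_imag_unit (esym Jk)).
have cJ : aconj S J = areal t - J by rewrite -tr /atrace addrC addKr.
have tJ : t *: J = areal (n - 1).
  move: nr; rewrite /asqnorm cJ amulDr amulNr JJ opprK /areal amulZr amul1r.
  by rewrite scalerBl scale1r => <-; rewrite addrK.
have [t0|t0] := eqVneq t 0; first by rewrite cJ t0 /areal scale0r add0r.
case: (@real_neq_imag_unit (t^-1 * (n - 1))).
by rewrite /areal -scalerA -[_ *: one]tJ scalerA mulVf// scale1r.
Qed.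

Lemma slice_pointD z w : slice_point (z + w) J = slice_point z J + slice_point w J.
Proof. by rewrite /slice_point /areal /= !scalerDl addrACA. Qed.

Lemma slice_pointN z : slice_point (- z) J = - slice_point z J.
Proof. by rewrite /slice_point /areal /= !scaleNr opprD. Qed.

Lemma amul_slice_point z x : slice_point z J ** x = z.1 *: x + z.2 *: (J ** x).
Proof. by rewrite /slice_point amulDl /areal !amulZl amul1l. Qed.

(** As J J = - 1, the plane spanned by the unity and J is a copy of the complex field; computations
    inside one slice are complex arithmetic. *)
Lemma slice_pointM z w :
  slice_point z J ** slice_point w J = slice_point (cmul z w) J.
Proof.
rewrite amul_slice_point /slice_point /areal amulDr !amulZr amul1r imag_unit_sqr.
rewrite !scalerDr !scalerA /cmul /= scalerN scalerBl scalerDl addrACA.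
by rewrite [X in _ + X = _]addrC addrACA [X in _ + X = _]addrC.
Qed.

Lemma aconj_slice_point z : aconj S (slice_point z J) = slice_point (cconj z) J.
Proof.
by rewrite /slice_point /areal aconjD !aconjZ aconj1 aconj_imag_unit scalerN scaleNr.
Qed.

Lemma atrace_slice_point z : atrace S (slice_point z J) = areal (2 * z.1).
Proof.
rewrite /atrace aconj_slice_point /slice_point /areal /= scaleNr addrACA subrr.
by rewrite addr0 -scalerDl; congr (_ *: _); ring.
Qed.

Lemma asqnorm_slice_point z :
  asqnorm S (slice_point z J) = areal (z.1 ^+ 2 + z.2 ^+ 2).
Proof.
rewrite /asqnorm aconj_slice_point slice_pointM /cmul /slice_point /=.
rewrite (_ : z.1 * - z.2 + z.2 * z.1 = 0) ?scale0r ?addr0; last by ring.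
by congr areal; ring.
Qed.

Lemma slice_point_in_cone z : quadratic_cone S (slice_point z J).
Proof.
have [z0|z0] := eqVneq z.2 0.
  by left; exists z.1; rewrite /slice_point z0 scale0r addr0.
right; exists (2 * z.1), (z.1 ^+ 2 + z.2 ^+ 2); split.
- exact: atrace_slice_point.
- exact: asqnorm_slice_point.
- have : 0 < z.2 ^+ 2 by rewrite exprn_even_gt0.
  by rewrite exprMn; lra.
Qed.

Lemma norm_slice_point z : norm_compatible S -> `|slice_point z J| = cmod z.
Proof.
move=> nS; exact: nS (slice_point_in_cone z) (asqnorm_slice_point z).
Qed.

End ImaginaryUnit.

(** Trace and squared norm recover the real part and the modulus, so z' is z or its conjugate;
    comparing imaginary parts then determines J' unless z is real. *)
Lemma slice_point_eq J J' z z' : imag_units S J -> imag_units S J' ->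
  slice_point z J = slice_point z' J' ->
  (z' = z /\ (z.2 = 0 \/ J' = J)) \/ (z' = cconj z /\ J' = - J).
Proof.
move=> HJ HJ' e.
have e1 : z'.1 = z.1.
  have := congr1 (atrace S) e; rewrite !atrace_slice_point // => /areal_inj.
  by move=> h; apply: (@mulfI _ 2) => //; rewrite h.
have e2 : z'.2 ^+ 2 = z.2 ^+ 2.
  have := congr1 (asqnorm S) e; rewrite !asqnorm_slice_point // => /areal_inj.
  by rewrite e1 => /addrI.
have eJ : z.2 *: J = z'.2 *: J'.
  by move: e; rewrite /slice_point e1 => /addrI.
move/eqP: e2; rewrite eqf_sqr => /orP[] /eqP e2.
- left; split; first by case: z z' e1 e2 {e eJ} => [? ?] [? ?] /= -> ->.
  have [->|z0] := eqVneq z.2 0; [by left|right].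
  by apply: (scalerI z0); rewrite eJ e2.
- have [z0|z0] := eqVneq z.2 0.
    left; split; last by left.
    by case: z z' e1 e2 z0 {e eJ} => [? ?] [? ?] /= -> -> ->; rewrite oppr0.
  right; split; first by case: z z' e1 e2 {e eJ z0} => [? ?] [? ?] /= -> ->.
  by apply: (scalerI z0); rewrite scalerN eJ e2 scaleNr opprK.
Qed.

Lemma slice_functionE (F : R * R -> A * A) J z : imag_units S J ->
  ((F (cconj z)).1 = (F z).1 /\ (F (cconj z)).2 = - (F z).2) ->
  slice_function S F (slice_point z J) = (F z).1 + J ** (F z).2.
Proof.
move=> HJ [F1 F2]; apply: xget_unique; first by exists z, J.
move=> v [z' [J' [HJ' e ->]]].
have [[-> [z0|->//]]|[-> ->]] := slice_point_eq HJ HJ' e.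
  (* For real [z] the unit [J'] is arbitrary, but the second component is its own opposite and
     vanishes. *)
  suff -> : (F z).2 = 0 by rewrite !amul0r.
  have zz : cconj z = z by case: z z0 {e F1 F2} => ? ? /= ->; rewrite /cconj /= oppr0.
  have : (F z).2 *+ 2 = 0 by rewrite mulr2n -{1}zz F2 addNr.
  by rewrite -scaler_nat => /eqP; rewrite scaler_eq0 pnatr_eq0 /= => /eqP.
by rewrite F1 F2 amulNr amulNl opprK.
Qed.

Lemma cone_slice_point x : imag_units S !=set0 -> quadratic_cone S x ->
  exists z J, imag_units S J /\ x = slice_point z J.
Proof.
move=> [J0 HJ0] [[k ->]|[t [n [tr nr tn]]]].
  by exists (k, 0), J0; split => //; rewrite /slice_point /= scale0r addr0.
have bb0 : 0 < n - t ^+ 2 / 4 by lra.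
(* Completing the square in x^2 = t x - n gives (x - t/2)^2 = - (n - t^2/4), so dividing x - t/2 by
   [be] yields an imaginary unit. *)
pose be := Num.sqrt (n - t ^+ 2 / 4).
have be0 : be != 0 by rewrite gt_eqF// sqrtr_gt0.
have be2 : be ^+ 2 = n - t ^+ 2 / 4 by rewrite sqr_sqrtr// ltW.
pose J := be^-1 *: (x - areal (t / 2)).
have cx : aconj S x = areal t - x by rewrite -tr /atrace addrC addKr.
have xx : x ** x = t *: x - areal n.
  by rewrite -nr /asqnorm cx amulDr amulNr /areal amulZr amul1r opprD opprK addNKr.
have JJ : J ** J = - one.
  rewrite /J amulZl amulZr scalerA amulDl !amulDr !amulNl !amulNr opprK xx.
  rewrite /areal !amulZl !amulZr !amul1l amul1r !scalerA.
  have -> : t *: x - n *: one - (t / 2) *: x +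
      (- ((t / 2) *: x) + (t / 2 * (t / 2)) *: one)
    = - (be ^+ 2) *: one.
    rewrite be2 [X in X + _]addrAC -scalerBl addrAC addrA -scalerBl.
    rewrite (_ : t - t / 2 - t / 2 = 0); last by field.
    rewrite scale0r add0r -scalerBl; congr (_ *: _); by field.
  by rewrite scalerA -invfM -expr2 mulrN mulVf ?scaleN1r// expf_neq0.
have cJ : aconj S J = - J.
  rewrite /J aconjZ aconjD cx aconjN /areal aconjZ aconj1 -[RHS]scalerN.
  congr (_ *: _); rewrite opprB addrAC; congr (_ - _).
  by rewrite -scalerBl; congr (_ *: _); by field.
exists (t / 2, be), J; split; last first.
  by rewrite /slice_point /J /= scalerA mulfV// scale1r addrC subrK.
split => //; right; exists 0, 1; split.
- by rewrite /atrace cJ subrr /areal scale0r.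
- by rewrite /asqnorm cJ amulNr JJ opprK /areal scale1r.
- by rewrite expr0n /= mulr1.
Qed.

End StarAlgebra.

(** * Stem functions of the two kinds of powers *)

Section Stems.
Context {R : realType} {A : normedModType R} (S : alt_star_algebra A).
Implicit Types (a : A) (p q z : R * R).
Local Notation "x ** y" := (amul S x y) (at level 40, left associativity).

(** The complex scalar action on the tensor product, [acI] being multiplication by i. *)
Definition cscale (p : R * R) (v : A * A) : A * A := p.1 *: v + p.2 *: acI v.

(* half_stem J a is e+ a and half_stem (- J) a is e- a. *)
Definition half_stem (J a : A) : A * A := (2^-1 *: a, - (2^-1 *: (J ** a))).

(** The common shape p (e+ a) + q (e- a) of all stem functions below; for a = 1, products act
    separately on [p] and [q]. *)
Definition comb (J : A) p q a : A * A :=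
  cscale p (half_stem J a) + cscale q (half_stem (- J) a).

Lemma combE J p q a : comb J p q a =
  (((p.1 + q.1) / 2) *: a + ((p.2 - q.2) / 2) *: (J ** a),
   ((p.2 + q.2) / 2) *: a - ((p.1 - q.1) / 2) *: (J ** a)).
Proof.
rewrite /comb /cscale /half_stem /acI amulNl; apply/pair_equal_spec.
rewrite /= !scalerN !opprK !scalerA; split.
- rewrite addrACA -scalerDl -mulrDl -scalerBl -mulrBl; by congr (_ + _).
- rewrite addrACA [LHS]addrC -scalerDl -mulrDl; congr (_ + _).
  by rewrite mulrBl scalerBl opprB addrC.
Qed.

(** Conjugation in the complex factor exchanges e+ and e- and conjugates scalars, whence the swap of
    [p] and [q]. *)
Lemma comb_cconj J p q a :
  comb J (cconj q) (cconj p) a = ((comb J p q a).1, - (comb J p q a).2).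
Proof.
rewrite !combE /cconj /=; apply/pair_equal_spec; split.
  by congr (_ *: _ + _ *: _); ring.
by rewrite opprD -!(@scaleNr _ A); congr (_ *: _ + _ *: _); ring.
Qed.

Lemma combDr J p q a a' : comb J p q (a + a') = comb J p q a + comb J p q a'.
Proof.
rewrite !combE amulDr !scalerDr opprD; apply/pair_equal_spec.
by split; exact: addrACA.
Qed.

Lemma combZr J p q (k : R) a : comb J p q (k *: a) = comb J (k *: p) (k *: q) a.
Proof.
rewrite !combE amulZr !scalerA /= -!(mulrDr k) -!(mulrBr k).
by congr (_ *: _ + _ *: _, _ *: _ - _ *: _); ring.
Qed.

(** Coordinates of [a] move onto the complex factors, which reduces series in the algebra to scalar
    ones. *)
Lemma comb_sum J p q d (c : nat -> R) (b : nat -> A) :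
  comb J p q (lincomb d b c) =
  \sum_(i < d) comb J (c i *: p) (c i *: q) (b i).
Proof.
rewrite /lincomb; elim: d => [|d IH].
  by rewrite !big_ord0 combE amul0r !scaler0 subr0 addr0.
by rewrite !big_ord_recr /= -IH combDr combZr.
Qed.

Section AtImaginaryUnit.
Variable J : A.
Hypothesis HJ : imag_units S J.

Lemma comb_aone p q : comb J p q (aone S) =
  (slice_point S ((p.1 + q.1) / 2, (p.2 - q.2) / 2) J,
   slice_point S ((p.2 + q.2) / 2, - ((p.1 - q.1) / 2)) J).
Proof. by rewrite combE amul1r /slice_point /areal /= scaleNr. Qed.

(** Both components of the left factor are real combinations of the unity and J, so bilinearity
    alone computes the product. *)
Lemma acmul_comb_alg p q a :
  acmul S (comb J p q (aone S)) (ac_of_alg a) = comb J p q a.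
Proof.
rewrite comb_aone combE /acmul /ac_of_alg /= !amul0r subr0 add0r.
by rewrite !amul_slice_point /= scaleNr.
Qed.

(** e+ and e- are orthogonal idempotents, and all components lie in the slice of J, where
    multiplication is complex. *)
Lemma acmul_comb p q p' q' :
  acmul S (comb J p q (aone S)) (comb J p' q' (aone S)) =
  comb J (cmul p p') (cmul q q') (aone S).
Proof.
rewrite !comb_aone /acmul /= !(slice_pointM HJ) -slice_pointN -!slice_pointD.
apply/pair_equal_spec; split; congr slice_point; apply/pair_equal_spec.
all: by split; rewrite /cmul /=; field.
Qed.

Variables (y : A) (w : R * R).
Hypothesis yw : y = slice_point S w J.

Lemma linear_stemE z :
  ac_of_C S z - ac_of_alg y = comb J (z - w) (z - cconj w) (aone S).
Proof.
rewrite comb_aone yw /ac_of_C /ac_of_alg; apply/pair_equal_spec; split.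
  rewrite /= -slice_pointN /slice_point /= addrA -scalerDl.
  by congr (_ *: _ + _ *: _); field.
rewrite /= subr0 /slice_point /= subrr mul0r oppr0 scale0r addr0.
by congr (_ *: _); field.
Qed.

(** Both factors are the complex number (z - w)(z - conj w); the two orders match those in which
    alternating roots enter [cprod]. *)
Lemma Delta_stemE z : Delta_stem S y z =
  comb J (cmul (z - cconj w) (z - w)) (cmul (z - w) (z - cconj w)) (aone S).
Proof.
rewrite [cmul (z - w) _]cmulC comb_aone /Delta_stem yw (atrace_slice_point HJ).
rewrite (asqnorm_slice_point HJ) /acmul /ac_of_C /ac_of_alg /areal.
rewrite !subrr !mul0r oppr0 /slice_point /areal /= !scale0r !addr0.
rewrite !amulZl !amulZr !amul1r !amul0r !scaler0 !subr0 !add0r !scalerA.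
apply/pair_equal_spec; split => /=.
  by rewrite -scalerBl -scalerBl -scalerDl; congr (_ *: _); field.
by rewrite addr0 -scalerDl -scalerBl; congr (_ *: _); field.
Qed.

Definition product_stem (v : nat -> R * R) n a z :=
  comb J (cprod v n z) (cprod (fun k => cconj (v k)) n z) a.

Lemma power_stemE n z : acpow S (ac_of_C S z - ac_of_alg y) n =
  product_stem (fun=> w) n (aone S) z.
Proof.
elim: n => [|n IH].
  rewrite /product_stem comb_aone /= !subrr addr0 !mul0r oppr0.
  rewrite /slice_point /areal /= !scale0r !addr0.
  by rewrite (_ : (1 + 1) / 2 = 1) ?scale1r//; field.
by rewrite [LHS]/= -/(acpow _ _ _) IH linear_stemE acmul_comb.
Qed.

Lemma spherical_stemE n z : spherical_stem S y n z =
  product_stem (fun k => if odd k then cconj w else w) n (aone S) z.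
Proof.
set v := fun k => _.
have powE m : acpow S (Delta_stem S y z) m = product_stem v m.*2 (aone S) z.
  elim: m => [|m IH]; first exact: (power_stemE 0 z).
  rewrite doubleS [LHS]/= -/(acpow _ _ _) IH Delta_stemE acmul_comb /product_stem.
  by rewrite /= /v /= odd_double /= cconjK !cmulA.
rewrite /spherical_stem powE -[n in RHS]odd_double_half.
case: (odd n) => //; rewrite add1n linear_stemE acmul_comb /product_stem /=.
by rewrite /v odd_double !(cmulC (z - _)).
Qed.

Lemma product_stem_cconj v n a z : product_stem v n a (cconj z) =
  ((product_stem v n a z).1, - (product_stem v n a z).2).
Proof.
rewrite /product_stem cprod_cconj -comb_cconj; congr (comb _ _ _ _).
rewrite -cprod_cconj; congr cprod; apply: funext => k; by rewrite cconjK.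
Qed.

End AtImaginaryUnit.
End Stems.

(** * Regularity of the sums *)

Section Holomorphy.
Context {R : realType} {A : normedModType R}.

Lemma is_derive_scalel (V W : normedModType R) (f : V -> R) (z v : V) (l : R)
    (b : W) :
  is_derive z v f l -> is_derive z v (fun y => f y *: b) (l *: b).
Proof.
move=> [df fl].
suff h : (fun h : R => h^-1 *: (((fun y => f y *: b) \o shift z) (h *: v)
    - f z *: b)) @ 0^' --> l *: b.
  by apply: DeriveDef; [exact: cvgP h|exact: cvg_lim h].
under eq_fun do rewrite /= -scalerBl scalerA.
by apply: cvgZr_tmp; rewrite -fl; exact: df.
Qed.

Lemma is_derive_cscale (f : R * R -> R * R) (z v : R * R) (l : R * R) (b : A * A) :
  is_derive z v (fun y => (f y).1) l.1 -> is_derive z v (fun y => (f y).2) l.2 ->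
  is_derive z v (fun y => cscale (f y) b) (cscale l b).
Proof.
by move=> d1 d2; exact: is_deriveD (is_derive_scalel _ d1) (is_derive_scalel _ d2).
Qed.

Lemma cvg_cscale (T : Type) (F : set_system T) {FF : Filter F} (f : T -> R * R)
    (l : R * R) (b : A * A) :
  (f y).1 @[y --> F] --> l.1 -> (f y).2 @[y --> F] --> l.2 ->
  cscale (f y) b @[y --> F] --> cscale l b.
Proof. by move=> f1 f2; apply: cvgD; exact: cvgZr_tmp. Qed.

Lemma acID (x y : A * A) : acI (x + y) = acI x + acI y.
Proof. by rewrite /acI /= opprD. Qed.

Lemma acI_sum d (f : 'I_d -> A * A) : acI (\sum_(i < d) f i) = \sum_(i < d) acI (f i).
Proof.
by apply: (big_morph _ acID); rewrite /acI /= oppr0.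
Qed.

Lemma cscale_mulI (p : R * R) (b : A * A) :
  cscale (cmul p (0, 1)) b = acI (cscale p b).
Proof.
rewrite /cscale /cmul /acI /= !mulr0 !mulr1 sub0r addr0.
apply/pair_equal_spec; split; rewrite /= !scaleNr !scalerN ?opprD ?opprK addrC //.
Qed.

Lemma cmulz1 (p : R * R) : cmul p (1, 0) = p.
Proof. by rewrite cmulC cmul1z. Qed.

Lemma acIK (x : A * A) : acI (acI x) = - x.
Proof. by []. Qed.

(** The directional derivatives agree with [DF] on an open set, hence near each of its points, so
    continuity transfers; holomorphy is i applied twice giving - 1. *)
Lemma C1_holomorphic_of_derive (D : set (R * R)) (F : R * R -> A * A)
    (DF : R * R -> R * R -> A * A) :
  open D -> (forall z v, D z -> is_derive z v F (DF v z)) ->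
  (forall z v, D z -> {for z, continuous (DF v)}) ->
  (forall z, D z -> DF (0, 1) z = acI (DF (1, 0) z)) ->
  C1_on D F /\ holomorphic_on D F.
Proof.
move=> Dopen dF cF FI.
have cD z v : D z -> {for z, continuous (fun y => 'D_v F y)}.
  move=> Dz; have e y : D y -> DF v y = 'D_v F y.
    by move=> Dy; have [_ ->] := dF y v Dy.
  rewrite /prop_for /continuous_at -(e z Dz); apply: cvg_trans (cF z v Dz).
  apply: near_eq_cvg; have : nbhs z D by exact: open_nbhs_nbhs.
  by apply: filterS => y /e.
split=> z Dz.
  split; [by have [] := dF z (1, 0) Dz|by have [] := dF z (0, 1) Dz| |]; exact: cD.
rewrite /dalpha /dbeta; have [_ ->] := dF z (1, 0) Dz.
by have [_ ->] := dF z (0, 1) Dz; rewrite FI// acIK addrN.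
Qed.

End Holomorphy.

(** * Series with values in the algebra *)

Lemma cvg_series_scalel (R : realType) (W : normedModType R) (u : R^nat) (b : W) :
  cvgn (series u) ->
  series (fun n => u n *: b) @ \oo --> limn (series u) *: b.
Proof.
move=> uc; rewrite (_ : series _ = fun n => series u n *: b).
  exact: cvgZr_tmp.
by apply: funext => n; rewrite /series /= scaler_suml.
Qed.

Lemma cvg_seriesD (R : realType) (W : normedModType R) (u v : W^nat) (a b : W) :
  series u @ \oo --> a -> series v @ \oo --> b ->
  series (fun n => u n + v n) @ \oo --> a + b.
Proof.
move=> ua vb; rewrite (_ : series _ = fun n => series u n + series v n).
  exact: cvgD.
by apply: funext => n; rewrite /series /= big_split.
Qed.

Lemma cvg_series_sum (R : realType) (W : normedModType R) d (u : nat -> W^nat)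
    (a : nat -> W) :
  (forall i, (i < d)%N -> series (u i) @ \oo --> a i) ->
  series (fun n => \sum_(i < d) u i n) @ \oo --> \sum_(i < d) a i.
Proof.
elim: d => [|d IH] ua.
  rewrite big_ord0 (_ : series _ = fun=> 0); first exact: cvg_cst.
  by apply: funext => n; rewrite /series /= big1 // => i _; rewrite big_ord0.
under eq_fun do rewrite big_ord_recr; rewrite big_ord_recr /=.
by apply: cvg_seriesD; [apply: IH => i /ltnW; exact: ua|exact: ua].
Qed.

Section ProductStemSeries.
Context {R : realType} {A : normedModType R} (S : alt_star_algebra A).
Local Notation "x ** y" := (amul S x y) (at level 40, left associativity).

(** Coordinates can be chosen no larger than a constant times [|a n|], so they inherit its geometric
    bounds. *)
Lemma geometric_bound_coordinates (a : nat -> A) (r : R) : geometric_bound a r ->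
  exists d b (c : nat -> nat -> R), (forall n, a n = lincomb d b (c n)) /\
    forall i, (i < d)%N -> geometric_bound (fun n => c n i) r.
Proof.
move=> ar; have [d [b0 b0P]] := afindim S.
pose b i := oapp b0 0 (insub i).
have [C C0 bC] := bounded_coordinates_ex d b.
have [c cP] : exists c : nat -> nat -> R, forall n, a n = lincomb d b (c n) /\
    forall i, (i < d)%N -> `|c n i| <= C * `|a n|.
  suff /(_ _)/cid h : forall n, exists e : nat -> R, a n = lincomb d b e /\
      forall i, (i < d)%N -> `|e i| <= C * `|a n|.
    by exists (fun n => sval (h n)) => n; exact: svalP (h n).
  move=> n; have [c0 anE] := b0P (a n).
  have {}anE : a n = lincomb d b (fun i => oapp c0 0 (insub i)).
    by rewrite anE; apply: eq_bigr => i _; rewrite /b valK.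
  by have [e eE eC] := bC (fun i => oapp c0 0 (insub i)); exists e; rewrite eE anE.
exists d, b, c; split => [n|i id s sr]; first by have [] := cP n.
have [K K0 aK] := ar s sr; exists (C * K); first exact: mulr_ge0.
move=> n; have [_ /(_ i id)] := cP n; move/le_trans; apply.
by rewrite -mulrA ler_wpM2l.
Qed.

Lemma slice_value_cscale (I : A) (p : R * R) (b : A * A) :
  (cscale p b).1 + I ** (cscale p b).2 =
  p.1 *: (b.1 + I ** b.2) + p.2 *: ((acI b).1 + I ** (acI b).2).
Proof.
by rewrite /cscale /= amulDr !amulZr !scalerDr addrACA.
Qed.

Variables (J : A) (D : set (R * R)) (v : nat -> R * R) (r : R) (a : nat -> A).
Hypotheses (D0 : D !=set0) (Dopen : open D) (Dconj : forall z, D z -> D (cconj z)).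
Hypotheses (vgrowth : forall z, D z -> growth_at v r z)
  (vgrowth' : forall z, D z -> growth_at (fun k => cconj (v k)) r z)
  (ar : geometric_bound a r).

Let v' k := cconj (v k).

(** The common core of both statements. Growth is required for the roots [v], which act on e+, and
    for their conjugates, which act on e-. *)
Lemma product_stem_series_regular :
  series_slice_regular_on S (circularization S D)
    (fun n => slice_function S (product_stem S J v n (a n))).
Proof.
have [d [b [c [ac cr]]]] := geometric_bound_coordinates ar.
pose ci i n := c n i.
pose cs i z := cseries v (ci i) z.
pose cs' i z := cseries v' (ci i) z.
(* Summing over n within each coordinate leaves a finite sum of scalar series times fixed
   vectors. *)
pose F z := \sum_(i < d) comb S J (cs i z) (cs' i z) (b i).
(* The coefficients are real, so conjugating [z] conjugates the sums and exchanges the two root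
   sequences. *)
have csJ z i : D z -> (i < d)%N ->
    cs i (cconj z) = cconj (cs' i z) /\ cs' i (cconj z) = cconj (cs i z).
  move=> Dz id.
  have [c1 c2] := cvg_cseries (vgrowth Dz) (cr i id).
  have [c1' c2'] := cvg_cseries (vgrowth' Dz) (cr i id).
  have p1 n : cprod v n (cconj z) = cconj (cprod v' n z).
    rewrite -cprod_cconj; congr cprod; apply: funext => k.
    by rewrite /v' cconjK.
  have p2 n : cprod v' n (cconj z) = cconj (cprod v n z) by rewrite -cprod_cconj.
  rewrite /cs /cs' /cseries; split; rewrite /cconj; apply/pair_equal_spec.
  - split; first by congr (limn (series _)); apply: funext => n; rewrite p1.
    rewrite -limN//; congr (lim (_ @ \oo)); apply: funext => n.
    by rewrite /series /= fctE -sumrN; apply: eq_bigr => k _; rewrite p1 /= mulrN.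
  - split; first by congr (limn (series _)); apply: funext => n; rewrite p2.
    rewrite -limN//; congr (lim (_ @ \oo)); apply: funext => n.
    by rewrite /series /= fctE -sumrN; apply: eq_bigr => k _; rewrite p2 /= mulrN.
have Fstem : stem_function D F.
  move=> z Dz; rewrite /F.
  have -> : \sum_(i < d) comb S J (cs i (cconj z)) (cs' i (cconj z)) (b i) =
      \sum_(i < d) ((comb S J (cs i z) (cs' i z) (b i)).1,
                    - (comb S J (cs i z) (cs' i z) (b i)).2).
    apply: eq_bigr => i _; have [-> ->] := csJ z i Dz (ltn_ord i).
    exact: comb_cconj.
  elim/big_ind2 : _ => [|x1 x2 y1 y2 [e1 e2] [e1' e2']|//].
    by rewrite /= oppr0.
  by rewrite /= e1 e2 e1' e2' opprD.
have [FC1 Fhol] : C1_on D F /\ holomorphic_on D F.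
  pose DF (u z : R * R) := \sum_(i < d)
    comb S J (cmul (cseries_deriv v (ci i) z) u)
             (cmul (cseries_deriv v' (ci i) z) u) (b i).
  apply: (@C1_holomorphic_of_derive _ _ _ _ DF) => //.
  - move=> z u Dz; rewrite /F.
    rewrite (_ : (fun z => _) = \sum_(i < d)
        (fun z => comb S J (cs i z) (cs' i z) (b i))); last first.
      by apply: funext => y; rewrite fct_sumE.
    apply: is_derive_sum => i.
    have [d1 d2] := is_derive_cseries (vgrowth Dz) (cr i (ltn_ord i)) u.
    have [d1' d2'] := is_derive_cseries (vgrowth' Dz) (cr i (ltn_ord i)) u.
    exact: is_deriveD (is_derive_cscale _ d1 d2) (is_derive_cscale _ d1' d2').
  - move=> z u Dz; rewrite /prop_for /continuous_at /DF.
    apply: (@cvg_big (A * A)%type _ +%R 0 xpredT add_continuous _ (nbhs z) _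
      (fun (i : 'I_d) y => comb S J (cmul (cseries_deriv v (ci i) y) u)
        (cmul (cseries_deriv v' (ci i) y) u) (b i))).
    move=> i _.
    have [d1 d2] := continuous_cseries_deriv (vgrowth Dz) (cr i (ltn_ord i)).
    have [d1' d2'] := continuous_cseries_deriv (vgrowth' Dz) (cr i (ltn_ord i)).
    by apply: cvgD; apply: cvg_cscale; [apply: cvgB|apply: cvgD|apply: cvgB|apply: cvgD];
      apply: cvgM => //; exact: cvg_cst.
  - move=> z Dz; rewrite /DF acI_sum; apply: eq_bigr => i _.
    by rewrite /comb !cscale_mulI acID !cmulz1.
(* At a point of the slice of [I], the series splits into finitely many real series times fixed
   vectors, giving convergence and sum together. *)
have Fval x : circularization S D x ->
    series (fun n => slice_function S (product_stem S J v n (a n)) x) @ \oo -->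
    slice_function S F x.
  move=> [z [I [Dz HI ->]]].
  rewrite (slice_functionE HI (Fstem z Dz)).
  have LE n : slice_function S (product_stem S J v n (a n)) (slice_point S z I) =
      \sum_(i < d)
        ((comb S J (ci i n *: cprod v n z) (ci i n *: cprod v' n z) (b i)).1 +
         I ** (comb S J (ci i n *: cprod v n z) (ci i n *: cprod v' n z) (b i)).2).
    rewrite slice_functionE//; last by rewrite product_stem_cconj.
    rewrite /product_stem ac comb_sum -/v'.
    elim/big_rec2 : _ => [|i x1 x2 _ <-]; first by rewrite amul0r addr0.
    by rewrite /= amulDr addrACA.
  under eq_fun do rewrite LE.
  have -> : (F z).1 + I ** (F z).2 = \sum_(i < d)
      ((comb S J (cs i z) (cs' i z) (b i)).1 +
       I ** (comb S J (cs i z) (cs' i z) (b i)).2).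
    rewrite /F; elim/big_rec2 : _ => [|i x1 x2 _ <-]; first by rewrite amul0r addr0.
    by rewrite /= amulDr addrACA.
  apply: (@cvg_series_sum _ _ d (fun i n =>
    (comb S J (ci i n *: cprod v n z) (ci i n *: cprod v' n z) (b i)).1 +
    I ** (comb S J (ci i n *: cprod v n z) (ci i n *: cprod v' n z) (b i)).2)
    (fun i => (comb S J (cs i z) (cs' i z) (b i)).1 +
       I ** (comb S J (cs i z) (cs' i z) (b i)).2)) => i id.
  have [c1 c2] := cvg_cseries (vgrowth Dz) (cr i id).
  have [c1' c2'] := cvg_cseries (vgrowth' Dz) (cr i id).
  have split_comb p q : (comb S J p q (b i)).1 + I ** (comb S J p q (b i)).2 =
     ((cscale p (half_stem S J (b i))).1 + I ** (cscale p (half_stem S J (b i))).2) +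
     ((cscale q (half_stem S (- J) (b i))).1 +
      I ** (cscale q (half_stem S (- J) (b i))).2).
    by rewrite /comb /= amulDr addrACA.
  under eq_fun do rewrite split_comb !slice_value_cscale.
  rewrite split_comb !slice_value_cscale.
  by apply: cvg_seriesD; apply: cvg_seriesD; exact: cvg_series_scalel.
have Flim x : circularization S D x ->
    limn (series (fun n => slice_function S (product_stem S J v n (a n)) x)) =
    slice_function S F x.
  by move=> Dx; apply: cvg_lim; [exact: norm_hausdorff|exact: Fval].
split; first by move=> x Dx; apply: cvgP (Fval x Dx).
exists D, F; split; first by split.
split=> //; split=> //.
Qed.

End ProductStemSeries.

(** * Growth of the products on the two plane domains *)

Section Domains.
Context {R : realType}.
Implicit Types (z w : R * R).

Lemma growth_at_cst w (r : R) z : cmod (z - w) < r -> growth_at (fun=> w) r z.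
Proof.
move=> zr; pose d := (r - cmod (z - w)) / 2.
have d0 : 0 < d by rewrite /d; lra.
have m0 := cmod_ge0 (z - w).
exists d, 1, (cmod (z - w) + d); split => //.
  by apply/andP; split; rewrite /d; lra.
by move=> n; rewrite prodr_const card_ord mul1r.
Qed.

(** Factors are grouped in consecutive pairs, so the rate is the geometric mean of the two enlarged
    distances; the unpaired factor for odd n goes into the constant. *)
Lemma growth_at_alternating w0 w1 (r : R) z :
  0 < r -> cmod (z - w0) * cmod (z - w1) < r ^+ 2 ->
  growth_at (fun k => if odd k then w1 else w0) r z.
Proof.
set x := cmod (z - w0); set y := cmod (z - w1) => r0 xyr.
have x0 : 0 <= x by exact: cmod_ge0.
have y0 : 0 <= y by exact: cmod_ge0.
(* As d <= 1, (x + d)(y + d) exceeds x y by at most d (x + y + 1), that is, by at most half the gap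
   to r^2. *)
pose d := Num.min 1 ((r ^+ 2 - x * y) / (2 * (x + y + 1))).
have s0 : 0 < 2 * (x + y + 1) by lra.
have d0 : 0 < d by rewrite lt_min ltr01 divr_gt0// subr_gt0.
have d1 : d <= 1 by rewrite ge_min lexx.
have d2 : d * (2 * (x + y + 1)) <= r ^+ 2 - x * y.
  by rewrite -ler_pdivlMr// ge_min lexx orbT.
have xy0 : 0 < (x + d) * (y + d) by rewrite mulr_gt0; lra.
have xyd : (x + d) * (y + d) < r ^+ 2 by nra.
pose q := Num.sqrt ((x + d) * (y + d)).
have q0 : 0 < q by rewrite sqrtr_gt0.
have q2 : q ^+ 2 = (x + d) * (y + d) by rewrite sqr_sqrtr// ltW.
have qr : q < r by rewrite -ltr_sqr ?nnegrE ?ltW// q2.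
have xq : 0 <= (x + d) / q := divr_ge0 (addr_ge0 x0 (ltW d0)) (ltW q0).
exists d, (1 + (x + d) / q), q; split => //.
- by rewrite addr_ge0.
- by rewrite q0.
pose v (k : nat) := if odd k then w1 else w0.
have even m : \prod_(k < m.*2) (cmod (z - v k) + d) = q ^+ m.*2.
  elim: m => [|m IH]; first by rewrite big_ord0.
  rewrite doubleS !big_ord_recr /= IH /v /= odd_double /= -/x -/y -mulrA -q2.
  by rewrite -exprD addn2.
move=> n; change (\prod_(k < n) (cmod (z - v k) + d) <= (1 + (x + d) / q) * q ^+ n).
rewrite -[n]odd_double_half; case: (odd n); last first.
  by rewrite add0n even ler_peMl ?exprn_ge0 ?(ltW q0)// lerDl.
rewrite add1n big_ord_recr /= even /v odd_double -/x exprS mulrA mulrC.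
rewrite ler_wpM2r ?exprn_ge0 ?(ltW q0)// mulrDl divfK ?gt_eqF// mul1r lerDr.
exact: ltW.
Qed.

Lemma open_cmod_lt (f : R * R -> R) (x : R) :
  continuous f -> open [set z | f z < x].
Proof.
move=> cf; apply: (@open_comp _ _ f [set y | y < x]); first by move=> z _; exact: cf.
exact: open_lt.
Qed.

Lemma continuous_cmodB w : continuous (fun z => cmod (z - w)).
Proof.
move=> z; apply: continuous_comp; last exact: cmod_continuous.
by apply: cvgB; [exact: cvg_id|exact: cvg_cst].
Qed.

Lemma cmod_cconjB z w : cmod (cconj z - w) = cmod (z - cconj w).
Proof. by rewrite -cmod_cconj cconjB cconjK. Qed.

End Domains.

(** * The two domains in the algebra as circularizations *)

Section Balls.
Context {R : realType} {A : normedModType R} (S : alt_star_algebra A).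
Variables (J y : A) (w : R * R) (r : R).
Hypotheses (HJ : imag_units S J) (yw : y = slice_point S w J).

(** Another representation of [y] at most conjugates [w], which swaps the two discs. *)
Lemma Omega_ballE :
  Omega_ball S y r = circularization S (cdisc w r `&` cdisc (cconj w) r).
Proof.
apply/seteqP; split => x; last by move=> Dx; exists w, J.
move=> [w' [J' [HJ' yw' Dx]]].
have [[<- _//]|[w'w _]] := slice_point_eq HJ HJ' (etrans (esym yw) yw').
by move: Dx; rewrite w'w cconjK setIC.
Qed.

(** Trace and squared norm of [y] are real, so [Delta] stays in the slice of its argument and equals
    (z - w)(z - conj w) there; on a slice the norm is the complex modulus. *)
Lemma U_ballE : imag_units S !=set0 -> norm_compatible S -> 0 < r ->
  U_ball S y r =
  circularization S [set z | cmod (z - w) * cmod (z - cconj w) < r ^+ 2].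
Proof.
move=> S0 nS r0.
have ballE z I : imag_units S I ->
    (Num.sqrt `|Delta S y (slice_point S z I)| < r) =
    (cmod (z - w) * cmod (z - cconj w) < r ^+ 2).
  move=> HI; rewrite /Delta (slice_pointM HI) yw (atrace_slice_point HJ).
  rewrite (asqnorm_slice_point HJ) /areal !amulZr amul1r.
  rewrite (_ : _ + _ = slice_point S (cmul (z - w) (z - cconj w)) I).
    rewrite norm_slice_point// cmodM -ltr_sqr ?nnegrE ?sqrtr_ge0 ?(ltW r0)//.
    by rewrite sqr_sqrtr// mulr_ge0 ?cmod_ge0.
  rewrite /slice_point /areal scalerDr !scalerA opprD addrACA -scalerBl -scalerBl.
  rewrite addrAC -scalerDl.
  by congr (_ *: _ + _ *: _); rewrite /cmul /=; ring.
apply/seteqP; split => x.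
  move=> [Qx]; have [z [I [HI ->]]] := cone_slice_point S0 Qx.
  by rewrite ballE// => zr; exists z, I.
move=> [z [I [zr HI ->]]]; split; first exact: slice_point_in_cone.
by rewrite ballE.
Qed.

End Balls.

(** * The power series and the spherical series as product series *)

Unset Implicit Arguments.

Theorem corollary3p5 (R : realType) (A : normedModType R)
  (S : alt_star_algebra A)
  (S_A_neq0 : imag_units S !=set0)
  (normA : norm_compatible S)
  (y : A) (Qy : quadratic_cone S y)
  (a : nat -> A) (r : R) (r_ge0 : 0 <= r)
  (limsup_a :
    limn_esup (fun n : nat => (`|a n| `^ (n%:R^-1))%:E) = (r%:E^-1)%E)
  (r_gt0 : 0 < r) :
  (Omega_ball S y r !=set0 ->
   series_slice_regular_on S (Omega_ball S y r)
     (fun n x => slice_power S y n (a n) x)) /\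
  series_slice_regular_on S (U_ball S y r)
    (fun n x => spherical_power S y n (a n) x).
Proof.
have [w [J [HJ yw]]] := cone_slice_point S_A_neq0 Qy.
have ar := geometric_bound_limn_esup limsup_a.
split.
- rewrite (Omega_ballE _ HJ yw) => -[x [z0 [I [Dz0 _ _]]]].
  have -> : (fun n x => slice_power S y n (a n) x) =
      (fun n => slice_function S (product_stem S J (fun=> w) n (a n))).
    apply: funext => n; congr slice_function; apply: funext => z.
    by rewrite (power_stemE HJ yw) acmul_comb_alg.
  apply: (@product_stem_series_regular _ _ _ _ _ _ r) => //.
  + by exists z0.
  + by apply: openI; apply: open_cmod_lt; exact: continuous_cmodB.
  + move=> z [z1 z2]; split.
      by rewrite -[_ (cconj z)]/(is_true (cmod (cconj z - w) < r)) cmod_cconjB.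
    rewrite -[_ (cconj z)]/(is_true (cmod (cconj z - cconj w) < r)).
    by rewrite cmod_cconjB cconjK.
  + by move=> z [z1 _]; exact: growth_at_cst.
  + by move=> z [_ z2]; exact: growth_at_cst.
- rewrite (U_ballE HJ yw)//.
  have -> : (fun n x => spherical_power S y n (a n) x) =
      (fun n => slice_function S
        (product_stem S J (fun k => if odd k then cconj w else w) n (a n))).
    apply: funext => n; congr slice_function; apply: funext => z.
    by rewrite (spherical_stemE HJ yw) acmul_comb_alg.
  apply: (@product_stem_series_regular _ _ _ _ _ _ r) => //.
  (* At [w] the first factor vanishes, so the domain is non-empty. *)
  + by exists w; rewrite /= subrr cmod0 mul0r exprn_gt0.
  + apply: open_cmod_lt => z.
    by apply: cvgM; exact: continuous_cmodB.
  + by move=> z /=; rewrite !cmod_cconjB cconjK mulrC.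
  + by move=> z /=; exact: growth_at_alternating.
  (* Conjugation swaps the two alternating roots, and the product of distances is symmetric in
     them. *)
  + move=> z /= zr.
    rewrite (_ : (fun k => _) = fun k => if odd k then w else cconj w).
      by apply: growth_at_alternating => //; rewrite mulrC.
    by apply: funext => k; case: odd; rewrite ?cconjK.
Qed.
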